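(* Let $M$ be a matroid on $[n]$ of rank $r\geq2$ and $\mathbf a=(a_1,\dots,a_n)\in\mathbb R^n_{>0}$. Then $\overline P_M$ has the $\mathrm{HRR}_1$ with respect to $\ell_{\mathbf a}=a_1\partial_1+\dots+a_n\partial_n$.
   Context: $P_M=\sum_{I\in\mathcal I(M)}\big(\prod_{i\in I}x_i\big)x_0^{n-|I|}\in\mathbb R[x_0,\dots,x_n]$ and $\overline P_M=\partial_0^{\,n-r}P_M$, homogeneous of degree $r$. Let $S=\mathbb R[\partial_0,\dots,\partial_n]$ act by differentiation; for homogeneous $g$ of degree $d$, $R_g=S/\{D:Dg=0\}$ graded, $[\,\cdot\,]:R_g^d\to\mathbb R$, $[D]=Dg$. $g$ has the $\mathrm{HRR}_1$ w.r.t. a linear form $\ell$ if $\times\ell^{d-2}:R_g^1\to R_g^{d-1}$ is an isomorphism and the form $(\xi_1,\xi_2)\mapsto-[\xi_1\ell^{d-2}\xi_2]$ on $R_g^1$ is positive definite on the kernel of $\times\ell^{d-1}:R_g^1\to R_g^d$. *)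

(* Defs.v *)
From HB Require Import structures.
From mathcomp Require Import all_boot all_order all_algebra.
From mathcomp Require Import generic_quotient ring_quotient ssrcomplements mpoly reals.

Set Implicit Arguments.
Unset Strict Implicit.
Unset Printing Implicit Defensive.

Import GRing.Theory Num.Theory.
Local Open Scope ring_scope.
Local Open Scope quotient_scope.

Record matroid (n : nat) := Matroid {
  indep : {set {set 'I_n}};
  indep0 : set0 \in indep;
  indepS : forall I J : {set 'I_n}, I \subset J -> J \in indep -> I \in indep;
  indep_aug : forall I J : {set 'I_n}, I \in indep -> J \in indep ->
    (#|I| < #|J|)%N -> exists2 e, e \in J :\: I & e |: I \in indep }.

Definition rank (n : nat) (M : matroid n) : nat := \max_(I in indep M) #|I|.

(* The variables x_0, x_1, ..., x_n are indexed by 'I_n.+1: x_0 is 'X_ord0, and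
   the variable of the ground-set element i : 'I_n is 'X_(lift ord0 i). *)
Definition indep_poly (R : comNzRingType) (n : nat) (M : matroid n) :
    {mpoly R[n.+1]} :=
  \sum_(I in indep M)
    (\prod_(i in I) 'X_(lift ord0 i)) * 'X_ord0 ^+ (n - #|I|).

Definition reduced_indep_poly (R : comNzRingType) (n : nat) (M : matroid n) :
    {mpoly R[n.+1]} :=
  (indep_poly R M)^`M(ord0, n - rank M).

(* A polynomial D also stands for the constant-coefficient differential
   operator obtained by reading 'X_i as the i-th partial derivative. *)
Definition diffop (R : comNzRingType) (k : nat) (D g : {mpoly R[k]}) :
    {mpoly R[k]} :=
  \sum_(m <- msupp D) D@_m *: g^`M[m].

Definition annihilator (R : comNzRingType) (k : nat) (g : {mpoly R[k]}) :
    pred {mpoly R[k]} :=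
  fun D => diffop D g == 0.

Section Annihilator.
Variables (R : comNzRingType) (k : nat).
Implicit Types D E g : {mpoly R[k]}.

Lemma diffopwE b D g : (msize D <= b)%N ->
  diffop D g = \sum_(m : 'X_{1..k < b}) D@_m *: g^`M[m].
Proof.
move=> lt_Db; pose P (m : 'X_{1..k < b}) := (val m) \in msupp D.
rewrite (bigID P) {}/P /= addrC big1 ?add0r; last first.
  by move=> m /memN_msupp_eq0 ->; rewrite scale0r.
rewrite /diffop (big_mksub 'X_{1..k < b}) //=; first exact/msupp_uniq.
by move=> m /msize_mdeg_lt /leq_trans; apply.
Qed.

Lemma diffopZD c D E g :
  diffop (c *: D + E) g = c *: diffop D g + diffop E g.
Proof.
set b := maxn (msize (c *: D + E)) (maxn (msize D) (msize E)).
rewrite !(@diffopwE b) ?leq_max ?leqnn ?orbT //.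
rewrite scaler_sumr -big_split /=; apply: eq_bigr => m _.
by rewrite mcoeffD mcoeffZ scalerDl scalerA.
Qed.

Lemma diffop0 g : diffop 0 g = 0.
Proof. by rewrite /diffop msupp0 big_nil. Qed.

Lemma diffopD D E g : diffop (D + E) g = diffop D g + diffop E g.
Proof. by rewrite -[D in LHS]scale1r diffopZD scale1r. Qed.

Lemma diffopZ c D g : diffop (c *: D) g = c *: diffop D g.
Proof. by rewrite -[_ *: D]addr0 diffopZD diffop0 addr0. Qed.

Lemma diffopN D g : diffop (- D) g = - diffop D g.
Proof. by rewrite -scaleN1r diffopZ scaleN1r. Qed.

Lemma diffopB D E g : diffop (D - E) g = diffop D g - diffop E g.
Proof. by rewrite diffopD diffopN. Qed.

Lemma diffopX m g : diffop 'X_[m] g = g^`M[m].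
Proof. by rewrite /diffop msuppX big_seq1 mcoeffX eqxx scale1r. Qed.

Lemma diffop_sum (I : Type) (s : seq I) (P : pred I) (F : I -> {mpoly R[k]}) g :
  diffop (\sum_(i <- s | P i) F i) g = \sum_(i <- s | P i) diffop (F i) g.
Proof.
apply: (big_morph (fun D => diffop D g) _ (diffop0 g)) => D E.
exact: diffopD.
Qed.

Lemma diffopr0 D : diffop D 0 = 0.
Proof. by rewrite /diffop big1 // => m _; rewrite raddf0 scaler0. Qed.

Lemma diffopM D E g : diffop (D * E) g = diffop D (diffop E g).
Proof.
rewrite [D in LHS]mpolyE mulr_suml diffop_sum.
apply: eq_bigr => m _; rewrite -scalerAl diffopZ; congr (_ *: _).
rewrite [E in LHS]mpolyE mulr_sumr diffop_sum raddf_sum /=.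
apply: eq_bigr => m' _; rewrite -scalerAr diffopZ linearZ /=; congr (_ *: _).
by rewrite -mpolyXD diffopX addmC mderivmDm.
Qed.

Lemma annihilator_zmod_closed g : zmod_closed (annihilator g).
Proof.
split; rewrite ?unfold_in ?diffop0 // => D E.
by rewrite !unfold_in diffopB => /eqP -> /eqP ->; rewrite subr0.
Qed.

HB.instance Definition _ g := GRing.isZmodClosed.Build {mpoly R[k]}
  (annihilator g) (annihilator_zmod_closed g).

Definition annihilator_zmod g : zmodClosed {mpoly R[k]} :=
  GRing.ZmodClosed.clone _ (annihilator g) _.

Lemma annihilatorMl g D E : E \in annihilator g -> D * E \in annihilator g.
Proof. by rewrite !unfold_in diffopM => /eqP ->; rewrite diffopr0. Qed.

(* The library's ring structure on quotients is restricted to proper ideals,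
   whereas the annihilator of g = 0 is the whole ring; the product is therefore
   set up here, yielding a possibly trivial commutative ring for every g. *)
Definition apolar (g : {mpoly R[k]}) := {ideal_quot annihilator_zmod g}.

HB.instance Definition _ g :
  EqQuotient {mpoly R[k]} (Quotient.equiv (annihilator_zmod g)) (apolar g) :=
  EqQuotient.on (apolar g).
HB.instance Definition _ g := GRing.Zmodule.on (apolar g).
HB.instance Definition _ g := isZmodQuotient.Build
  {mpoly R[k]} (Quotient.equiv (annihilator_zmod g)) 0 -%R +%R (apolar g)
  (lock _) (@Quotient.pi_opp _ (annihilator_zmod g))
  (@Quotient.pi_add _ (annihilator_zmod g)).

Definition apolar_one g : apolar g := \pi_(apolar g) 1.
Definition apolar_mul g (x y : apolar g) : apolar g :=
  \pi_(apolar g) (repr x * repr y : {mpoly R[k]}).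

Lemma apolar_eqP g D E :
  reflect (\pi_(apolar g) D = \pi_(apolar g) E) (D - E \in annihilator g).
Proof. by rewrite Quotient.idealrBE; apply: eqP. Qed.

Lemma pi_apolar_mul g D E :
  \pi_(apolar g) (D * E) = apolar_mul (\pi D) (\pi E).
Proof.
apply/apolar_eqP; set D' := repr _; set E' := repr _.
have hD : D - D' \in annihilator g by apply/apolar_eqP; rewrite reprK.
have hE : E - E' \in annihilator g by apply/apolar_eqP; rewrite reprK.
have -> : D * E - D' * E' = E * (D - D') + D' * (E - E').
  by rewrite !mulrBr [E * D]mulrC [E * D']mulrC addrA addrNK.
by rewrite rpredD ?annihilatorMl.
Qed.

Lemma apolar_mulA g : associative (@apolar_mul g).
Proof.
move=> x y z; rewrite -[x]reprK -[y]reprK -[z]reprK.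
by rewrite -!pi_apolar_mul mulrA.
Qed.

Lemma apolar_mulC g : commutative (@apolar_mul g).
Proof. by move=> x y; rewrite /apolar_mul mulrC. Qed.

Lemma apolar_mul1 g : left_id (apolar_one g) (@apolar_mul g).
Proof. by move=> x; rewrite -[x]reprK -pi_apolar_mul mul1r. Qed.

Lemma apolar_mulDl g : left_distributive (@apolar_mul g) +%R.
Proof.
move=> x y z; rewrite -[x]reprK -[y]reprK -[z]reprK.
by rewrite -raddfD -!pi_apolar_mul -raddfD mulrDl.
Qed.

HB.instance Definition _ g := GRing.Zmodule_isComPzRing.Build (apolar g)
  (@apolar_mulA g) (@apolar_mulC g) (@apolar_mul1 g) (@apolar_mulDl g).

Lemma pi_apolarM g D E :
  \pi_(apolar g) (D * E) = \pi_(apolar g) D * \pi_(apolar g) E.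
Proof. exact: pi_apolar_mul. Qed.

Definition apolar_deg (g : {mpoly R[k]}) (d : nat) (x : apolar g) : Prop :=
  exists2 D : {mpoly R[k]}, D \is d.-homog & x = \pi D.

(* D g is a constant when D and g are homogeneous of the same degree; it is
   identified with its constant coefficient. *)
Definition apolar_eval (g : {mpoly R[k]}) (x : apolar g) : R :=
  (diffop (repr x) g)@_0%MM.

Lemma apolar_eval_pi g D : apolar_eval (\pi_(apolar g) D) = (diffop D g)@_0%MM.
Proof.
have : repr (\pi_(apolar g) D) - D \in annihilator g.
  by apply/apolar_eqP; rewrite reprK.
by rewrite unfold_in diffopB subr_eq0 /apolar_eval => /eqP ->.
Qed.

Lemma diffop_dhomog d D g : D \is d.-homog -> g \is d.-homog ->
  diffop D g = ((diffop D g)@_0)%:MP_[k].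
Proof.
move=> /dhomogP hD hg; apply/mpolyP => m; rewrite mcoeffC.
have [->|nz_m] := eqVneq m 0%MM; first by rewrite mulr1.
rewrite mulr0 /diffop raddf_sum big_seq big1 //= => m' /hD /= deg_m'.
rewrite mcoeffZ mcoeff_mderivm (dhomog_nemf_coeff hg) ?mul0rn ?mulr0 //.
by rewrite /= mdegD deg_m' -{2}[d]addn0 eqn_add2l mdeg_eq0.
Qed.

End Annihilator.

Arguments apolar_deg {R k} g d x.
Arguments apolar_eval {R k} g x.

(* Throughout, g is meant to be homogeneous of degree d >= 2 and l to be a
   linear form, so the truncated subtractions d - 1 and d - 2 are exact. *)
Definition HR_form (R : realFieldType) (k d : nat) (g l : {mpoly R[k]})
    (x y : apolar g) : R :=
  - apolar_eval g (x * (\pi_(apolar g) l) ^+ (d - 2) * y).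

(* The first two clauses say that multiplication by l ^ (d - 2) is bijective
   from degree 1 to degree d - 1; it is automatically linear. *)
Definition HRR1 (R : realFieldType) (k d : nat) (g l : {mpoly R[k]}) : Prop :=
  let L := \pi_(apolar g) l in
  [/\ forall x y : apolar g, apolar_deg g 1 x -> apolar_deg g 1 y ->
        L ^+ (d - 2) * x = L ^+ (d - 2) * y -> x = y,
      forall y : apolar g, apolar_deg g (d - 1) y ->
        exists2 x : apolar g, apolar_deg g 1 x & L ^+ (d - 2) * x = y &
      forall x : apolar g, apolar_deg g 1 x -> L ^+ (d - 1) * x = 0 ->
        x != 0 -> 0 < HR_form d l x x].

Definition ell_form (R : comNzRingType) (n : nat) (a : 'I_n -> R) :
    {mpoly R[n.+1]} :=
  \sum_(i < n) a i *: 'X_(lift ord0 i).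

Lemma rank_le n (M : matroid n) : (rank M <= n)%N.
Proof.
by apply/bigmax_leqP => I _; rewrite -[n in (_ <= n)%N]card_ord max_card.
Qed.

Lemma reduced_indep_poly_dhomog (R : comNzRingType) n (M : matroid n) :
  reduced_indep_poly R M \is (rank M).-homog.
Proof.
have homP : indep_poly R M \is n.-homog.
  apply: rpred_sum => I _.
  have leI : (#|I| <= n)%N by rewrite -[n in (_ <= n)%N]card_ord max_card.
  suff : \prod_(i in I) 'X_(lift ord0 i) * 'X_ord0 ^+ (n - #|I|)
      \is [in R[n.+1], (#|I| + (n - #|I|)).-homog] by rewrite subnKC.
  apply: dhomogM.
    rewrite -sum1_card.
    apply: (big_rec2 (fun (p : {mpoly R[n.+1]}) d => p \is d.-homog)).
      exact: dhomog1.
    by move=> i d p _ hp; apply: dhomogM; rewrite // dhomogX /= mdeg1.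
  by rewrite -[X in X.-homog]mul1n; apply: dhomogMn; rewrite dhomogX /= mdeg1.
apply/dhomogP => m; rewrite mcoeff_msupp /reduced_indep_poly mcoeff_mderivm.
apply: contraNeq => /= ne_m; rewrite (dhomog_nemf_coeff homP) ?mul0rn //.
apply: contra ne_m; rewrite /= mdegD mdegMn mdeg1 mul1n => /eqP deg_m.
by rewrite -(eqn_add2l (n - rank M)) deg_m subnK ?rank_le.
Qed.

(* Main.v *)
Require Import Defs.
From HB Require Import structures.
From mathcomp Require Import all_boot all_order all_algebra.
From mathcomp Require Import mpoly reals ring lra zify.

(** Write [phi D] for the value of an operator of degree r on the polynomial:
    it is [(n - |I|)!] on the squarefree monomial of an independent set I
    completed by a power of the operator along x_0, and 0 on the other
    monomials. By induction on k one shows, for every independent t of size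
    r - k - 2 and every linear form v, that
    [phi (D_t v l^(k+1)) = 0] implies [phi (D_t v^2 l^k) <= 0], with equality
    only if [D_t v] kills the polynomial.

    For k = 0 this is an explicit inequality over the parallel classes of the
    contraction by t. For the step, expand one factor l = \sum a_i d_i: the
    induction hypothesis is a reversed Cauchy-Schwarz inequality for each
    d_i-derivative, and together they say Q(v) <= \sum_i y_i^2 / w_i, where
    y_i = a_i Q(d_i, v) and w_i is the i-th row sum of the matrix
    H_ij = a_i a_j Q(d_i, d_j). The Laplacian L = W - H is positive semidefinite
    with one-dimensional kernel, so y = L z for some z, and the same inequality
    at v + \sum z_i a_i d_i reads Q(v) <= - z L z <= 0. In the case of equality
    y = 0, so v annihilates all d_i-derivatives with i >= 1, and counting
    parallel classes on a line shows that it annihilates the polynomial. *)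

Set Implicit Arguments.
Unset Strict Implicit.
Unset Printing Implicit Defensive.

Import Order.TTheory GRing.Theory Num.Theory.
Local Open Scope ring_scope.

(** * Weighted graph Laplacians *)

Section Laplacian.
Variables (R : realFieldType) (n : nat) (H : 'I_n -> 'I_n -> R).
Hypothesis Hsym : forall i j, H i j = H j i.
Hypothesis Hge0 : forall i j, 0 <= H i j.

Let w i := \sum_j H i j.

(** Dirichlet form of the Laplacian: adding the sum with [i] and [j] exchanged completes each
    square. *)
Lemma laplacian_sum_squares (z : 'I_n -> R) :
  (\sum_i z i * (w i * z i - \sum_j H i j * z j)) *+ 2
  = \sum_i \sum_j H i j * (z i - z j) ^+ 2.
Proof.
have -> : \sum_i z i * (w i * z i - \sum_j H i j * z j)
    = \sum_i \sum_j H i j * (z i * (z i - z j)).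
  apply: eq_bigr => i _; rewrite /w mulr_suml -sumrB mulr_sumr.
  by apply: eq_bigr => j _; ring.
rewrite mulr2n [X in _ + X]exchange_big -big_split; apply: eq_bigr => i _ /=.
by rewrite -big_split; apply: eq_bigr => j _ /=; rewrite (Hsym j i); ring.
Qed.

Lemma laplacian_ge0 (z : 'I_n -> R) :
  0 <= \sum_i z i * (w i * z i - \sum_j H i j * z j).
Proof.
rewrite -(pmulrn_lge0 _ (isT : (0 < 2)%N)) laplacian_sum_squares.
by do 2!apply: sumr_ge0 => ? _; rewrite mulr_ge0 ?sqr_ge0.
Qed.

Lemma laplacian_eq0 (z : 'I_n -> R) :
  \sum_i z i * (w i * z i - \sum_j H i j * z j) = 0 ->
  forall i j, 0 < H i j -> z i = z j.
Proof.
move=> z0 i j Hij; have := laplacian_sum_squares z; rewrite z0 mul0rn.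
have ge0 i' j' : 0 <= H i' j' * (z i' - z j') ^+ 2.
  by rewrite mulr_ge0 ?sqr_ge0.
move/esym/eqP; rewrite psumr_eq0 => [|? _]; last exact: sumr_ge0.
move/allP/(_ i (mem_index_enum _)); rewrite /= psumr_eq0 //.
move/allP/(_ j (mem_index_enum _)); rewrite /= mulf_eq0 gt_eqF //=.
by rewrite sqrf_eq0 subr_eq0 => /eqP.
Qed.

Hypothesis Hconn : forall i j, w i != 0 -> w j != 0 ->
  0 < H i j \/ exists2 k, 0 < H i k & 0 < H j k.

(** By symmetry of [L], [y] lies in its image once it is orthogonal to its kernel. A kernel vector
    is constant along edges, hence by [Hconn] takes a single value where [w i != 0]; [y] vanishes
    elsewhere and has sum 0. *)
Lemma laplacian_solve (y : 'I_n -> R) :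
  (forall i, w i = 0 -> y i = 0) -> \sum_i y i = 0 ->
  exists z : 'I_n -> R, forall i, y i = w i * z i - \sum_j H i j * z j.
Proof.
move=> y0 sy0.
pose L : 'M[R]_n := \matrix_(i, j) (w i *+ (i == j) - H i j).
have LE (z : 'I_n -> R) i :
    \sum_j L i j * z j = w i * z i - \sum_j H i j * z j.
  under eq_bigr do rewrite mxE mulrBl; rewrite sumrB; congr (_ - _).
  rewrite (bigD1 i) //= eqxx mulr1n big1 ?addr0 // => j.
  by rewrite eq_sym => /negPf ->; rewrite mulr0n mul0r.
have /submxP [z yE] : (\row_i y i <= L)%MS.
  rewrite submxE; apply/eqP/rowP => j; rewrite !mxE.
  pose c i := cokermx L i j.
  have Lc i : w i * c i - \sum_j H i j * c j = 0.
    have := congr1 (fun A : 'M_n => A i j) (mulmx_coker L).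
    by rewrite !mxE => LE0; rewrite -LE.
  have /laplacian_eq0 cE :
      \sum_i c i * (w i * c i - \sum_j H i j * c j) = 0.
    by rewrite big1 // => i _; rewrite Lc mulr0.
  have cc i i' : w i != 0 -> w i' != 0 -> c i = c i'.
    move=> wi wi'; have [/cE//|[k /cE -> /cE ->//]] := Hconn wi wi'.
  have [i0 wi0|wn0] := pickP (fun i => w i != 0).
    rewrite (eq_bigr (fun i => y i * c i0)) => [|i _].
      by rewrite -mulr_suml sy0 mul0r.
    rewrite mxE; have [wi|wi] := eqVneq (w i) 0; first by rewrite y0 // !mul0r.
    by rewrite -/(c i) (cc i i0).
  by rewrite big1 // => i _; rewrite mxE y0 ?mul0r //; apply/eqP/negbFE/wn0.
exists (z ord0) => i; rewrite -LE.
have := congr1 (fun A : 'rV_n => A ord0 i) yE; rewrite !mxE => ->.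
apply: eq_bigr => j _; rewrite mulrC !mxE Hsym; congr ((_ - _) * _).
by have [->|] := eqVneq i j; rewrite ?eqxx // eq_sym => /negPf ->.
Qed.

(* Solving y = (W - H) z and evaluating the hypothesis at u = z bounds q by
   - z (W - H) z, which is nonpositive. *)
Lemma laplacian_form_le0 (q : R) (y : 'I_n -> R) :
  (forall i, w i = 0 -> y i = 0) -> \sum_i y i = 0 ->
  (forall u : 'I_n -> R,
     q + (\sum_i u i * y i) *+ 2 + \sum_i u i * \sum_j H i j * u j
     <= \sum_i (y i + \sum_j H i j * u j) ^+ 2 / w i) ->
  q <= 0 /\ (q = 0 -> forall i, y i = 0).
Proof.
move=> y0 sy0 qle; have [z yE] := laplacian_solve y0 sy0.
have := qle z.
rewrite [X in _ <= X](eq_bigr (fun i => z i * (w i * z i))) => [|i _]; last first.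
  (* Where [w i = 0] the quotient is 0 by the convention on inverses, in agreement with the
     right-hand side. *)
  rewrite yE subrK exprMn; have [->|wi] := eqVneq (w i) 0.
    by rewrite invr0 mul0r !mulr0.
  by field.
have zE : \sum_i z i * y i =
    \sum_i z i * (w i * z i) - \sum_i z i * \sum_j H i j * z j.
  by rewrite -sumrB; apply: eq_bigr => i _; rewrite yE mulrBr.
have zyE : \sum_i z i * y i = \sum_i z i * (w i * z i - \sum_j H i j * z j).
  by apply: eq_bigr => i _; rewrite yE.
have := laplacian_ge0 z; rewrite -zyE => z_ge0 hq.
have {}hq : q <= - \sum_i z i * y i by lra.
split=> [|q0 i]; first lra.
(* Equality makes the energy of [z] vanish, so [z] is constant along edges and its image [y] is
   0. *)
have /laplacian_eq0 zc : \sum_i z i * (w i * z i - \sum_j H i j * z j) = 0.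
  by rewrite -zyE; apply/eqP; rewrite eq_le z_ge0 andbT; lra.
rewrite yE /w mulr_suml -sumrB big1 // => j _.
have := Hge0 i j; rewrite le_eqVlt => /predU1P[<-|/zc ->]; last by rewrite subrr.
by rewrite !mul0r subrr.
Qed.

End Laplacian.

(** * Parallel classes *)

(** Variance decomposition: the last sum is the defect in Jensen's inequality, kept explicit for the
    equality case. *)
Lemma sum_sqr_mean (R : realFieldType) (I : finType) (P : pred I)
    (w y : I -> R) :
  0 < \sum_(i | P i) w i ->
  let m := (\sum_(i | P i) w i * y i) / \sum_(i | P i) w i in
  \sum_(i | P i) w i * y i ^+ 2
  = (\sum_(i | P i) w i * y i) ^+ 2 / (\sum_(i | P i) w i)
    + \sum_(i | P i) w i * (y i - m) ^+ 2.
Proof.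
set W := \sum_(i | P i) w i; set Y := \sum_(i | P i) w i * y i => W0 m.
rewrite [X in _ = _ + X](eq_bigr
  (fun i => w i * y i ^+ 2 - 2 * m * (w i * y i) + m ^+ 2 * w i)); last first.
  by move=> i _; ring.
rewrite big_split sumrB -!mulr_sumr /= -/W -/Y /m.
by field; rewrite gt_eqF.
Qed.

(** * Matroids as independent lists, their contractions and parallel classes *)

Section IndependentSequences.
Variable n : nat.

(** With lists, contracting by [t] is appending [t], and a repeated entry is dependent, just as a
    repeated derivative kills a squarefree product. *)
Definition indep_axioms (ind : pred (seq 'I_n)) : Prop :=
  [/\ forall s, ind s -> uniq s,
      forall s s', uniq s -> {subset s <= s'} -> ind s' -> ind s &
      forall s s', ind s -> ind s' -> (size s < size s')%N ->
        exists2 e, e \in s' & ind (e :: s)].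

Definition indep_seq (M : matroid n) : pred (seq 'I_n) :=
  fun s => uniq s && ([set x in s] \in indep M).

Lemma indep_seq_axioms M : indep_axioms (indep_seq M).
Proof.
split=> [s /andP[] //|s s' us ss' /andP[_ hs']|s s' /andP[us hs] /andP[us' hs'] lt].
  rewrite /indep_seq us /=; apply: indepS hs'.
  by apply/subsetP => x; rewrite !inE; apply: ss'.
have card t : uniq t -> #|[set x in t]| = size t by rewrite cardsE => /card_uniqP.
have [|e] := indep_aug hs hs'; first by rewrite !card.
rewrite !inE => /andP[es es'] ind; exists e => //.
rewrite /indep_seq /= es us; suff -> : [set x in e :: s] = e |: [set x in s] by [].
by apply/setP => x; rewrite !inE.
Qed.

Lemma indep_axioms_contract (ind : pred (seq 'I_n)) t :
  indep_axioms ind -> indep_axioms (fun s => ind (s ++ t)).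
Proof.
move=> [iu isub iaug]; split=> [s /iu|s s' us ss' ist|s s' hs hs' lt].
- by rewrite cat_uniq => /andP[].
- have := iu _ ist; rewrite cat_uniq => /and3P[_ ns't ut].
  apply: isub ist; last first.
    by move=> x; rewrite !mem_cat => /orP[/ss' ->|->]; rewrite ?orbT.
  rewrite cat_uniq us ut andbT; apply: contra ns't => /hasP[x xt xs].
  by apply/hasP; exists x => //; apply: ss'.
have [|e] := iaug _ _ hs hs'; first by rewrite !size_cat ltn_add2r.
rewrite mem_cat => /orP[es' ie|et ie]; first by exists e.
by have := iu _ ie; rewrite /= mem_cat et orbT.
Qed.

Variable ind : pred (seq 'I_n).
Hypothesis ind_ax : indep_axioms ind.

Let ind_uniq := let: And3 h _ _ := ind_ax in h.
Let ind_sub := let: And3 _ h _ := ind_ax in h.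
Let ind_aug := let: And3 _ _ h := ind_ax in h.

Lemma ind_perm s s' : perm_eq s s' -> ind s = ind s'.
Proof.
move=> ss'; apply/idP/idP => hs; apply: (ind_sub _ _ hs).
- by rewrite -(perm_uniq ss') ind_uniq.
- by move=> x; rewrite (perm_mem ss').
- by rewrite (perm_uniq ss') ind_uniq.
- by move=> x; rewrite (perm_mem ss').
Qed.

Lemma ind2C i j : ind [:: i; j] = ind [:: j; i].
Proof. by apply: ind_perm; rewrite (perm_catC [:: i] [:: j]). Qed.

Lemma ind_behead i s : ind (i :: s) -> ind s.
Proof.
move=> hs; apply: (ind_sub _ _ hs); last by move=> x xs; rewrite inE xs orbT.
by have := ind_uniq hs => /= /andP[].
Qed.

Lemma ind2_nonloop i j : ind [:: i; j] -> ind [:: i] /\ ind [:: j].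
Proof. by move=> ij; split; [rewrite ind2C in ij|]; apply: ind_behead ij. Qed.

Definition parallel i j := [&& ind [:: i], ind [:: j] & ~~ ind [:: i; j]].

Lemma parallelC i j : parallel i j = parallel j i.
Proof. by rewrite /parallel ind2C andbCA. Qed.

Lemma parallelxx i : parallel i i = ind [:: i].
Proof.
rewrite /parallel; case: (ind [:: i]) => //=.
by apply/negP => /ind_uniq; rewrite /= inE eqxx.
Qed.

Lemma parallel_trans i j k : parallel i j -> parallel j k -> parallel i k.
Proof.
move=> /and3P[hi hj nij] /and3P[_ hk njk]; rewrite /parallel hi hk /=.
apply/negP => hik; have [|e] := ind_aug hj hik; first by [].
rewrite !inE => /orP[]/eqP->; first by apply/negP.
by rewrite ind2C; apply/negP.
Qed.

Lemma parallel_eq i j k : parallel i j -> parallel i k = parallel j k.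
Proof.
move=> ij; apply/idP/idP; apply: parallel_trans; rewrite // parallelC //.
Qed.

(** For [k != l], augment [[:: l]] twice from the triple: the added element is never [k], which is
    parallel to [l], so [i] and [j] are added. *)
Lemma parallel_ind3 i j k l :
  parallel k l -> ind [:: k; i; j] -> ind [:: l; i; j].
Proof.
move=> /and3P[_ hl nkl] hkij.
have nlk (s : seq 'I_n) : k \in s -> l \in s -> k != l -> ~~ ind s.
  move=> ks ls kl; apply: contra nkl => hs; apply: (ind_sub _ _ hs).
    by rewrite /= inE kl.
  by move=> x; rewrite !inE => /orP[]/eqP->.
have [<-//|kl] := eqVneq k l.
have [//|e] := ind_aug hl hkij.
rewrite inE => /predU1P[->|eij hel].
  by move=> h; have := nlk [:: k; l]; rewrite h !inE !eqxx orbT => /(_ isT isT kl).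
have [//|f] := ind_aug hel hkij.
rewrite inE => /predU1P[->|fij hfel].
  by move=> h; have := nlk [:: k; e; l]; rewrite h !inE !eqxx !orbT => /(_ isT isT kl).
have := ind_uniq hkij; rewrite /= !inE => /and3P[_ ij _].
apply: (ind_sub _ _ hfel); last first.
  have := ind_uniq hfel; rewrite /= !inE !negb_or => /and3P[/andP[fe _] _ _].
  move: eij fij fe; rewrite !inE => /orP[]/eqP-> /orP[]/eqP->; rewrite ?eqxx // => _ x;
  by rewrite !inE => /or3P[]->; rewrite ?orbT.
have := ind_uniq hfel; rewrite /= !inE !negb_or => /and3P[/andP[fe fl] el _].
move: eij fij fe fl el; rewrite !inE => /orP[]/eqP-> /orP[]/eqP->;
by rewrite ?eqxx // ![l == _]eq_sym => _ -> ->; rewrite ij.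
Qed.

Variable R : realFieldType.
Implicit Types x y : 'I_n -> R.

Definition class_sum x i := \sum_(j | parallel i j) x j.
(** With these weights, a sum over nonloops of a function constant on classes is a sum over parallel
    classes, without a choice of representatives. *)
Definition class_weight i : R := (#|[pred j | parallel i j]|%:R)^-1.

Local Notation c := class_weight.

Lemma class_sum_parallel x i j : parallel i j -> class_sum x i = class_sum x j.
Proof. by move=> ij; apply: eq_bigl => k; apply: parallel_eq. Qed.

Lemma class_weight_parallel i j : parallel i j -> c i = c j.
Proof.
move=> ij; rewrite /class_weight; congr (_%:R^-1); apply: eq_card => k.
by rewrite !inE; apply: parallel_eq.
Qed.

Lemma class_weight_card i : ind [:: i] ->
  c i * #|[pred j | parallel i j]|%:R = 1.
Proof.
move=> hi; rewrite mulVf // pnatr_eq0 -lt0n; apply/card_gt0P.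
by exists i; rewrite inE parallelxx.
Qed.

Lemma class_weight_gt0 i : ind [:: i] -> 0 < c i.
Proof.
move=> hi; rewrite invr_gt0 ltr0n; apply/card_gt0P.
by exists i; rewrite inE parallelxx.
Qed.

Lemma class_weight_le1 i : ind [:: i] -> c i <= 1.
Proof.
move=> hi; rewrite invf_le1 ?ler1n ?ltr0n; apply/card_gt0P;
by exists i; rewrite inE parallelxx.
Qed.

Lemma sum_class_weight i : ind [:: i] -> \sum_(j | parallel i j) c j = 1.
Proof.
move=> hi; rewrite -(class_weight_card hi).
rewrite (eq_bigr (fun=> c i)) => [|j /class_weight_parallel//].
by rewrite sumr_const mulr_natr.
Qed.

Lemma sum_classes x (f : 'I_n -> R) :
  (forall i j, parallel i j -> f i = f j) ->
  \sum_(i | ind [:: i]) x i * f i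
  = \sum_(i | ind [:: i]) c i * class_sum x i * f i.
Proof.
move=> fP; pose F j := c j * x j * f j.
transitivity (\sum_(i | ind [:: i]) \sum_(j | parallel i j) F j); last first.
  apply: eq_bigr => i _; rewrite /class_sum mulr_sumr mulr_suml.
  apply: eq_bigr => j ij.
  by rewrite /F (class_weight_parallel ij) (fP _ _ ij).
(* Double counting: each [j] is met once for every member of its class, which cancels the weight. *)
rewrite (exchange_big_dep (fun j => ind [:: j])) /=; last first.
  by move=> i j _ /and3P[].
apply: eq_bigr => j hj; rewrite (eq_bigl (parallel j)); last first.
  move=> i; rewrite parallelC andb_idl // => /and3P[] //.
rewrite sumr_const -mulr_natr -[LHS]mul1r -[X in X * _ = _](class_weight_card hj) /F.
ring.
Qed.

(** The classes of [i] and [j] are disjoint, lie in [P], and contribute 1 each. *)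
Lemma sum_class_weight_ge2 (P : pred 'I_n) i j :
  ind [:: i; j] -> (forall k, P k -> ind [:: k]) ->
  (forall k, parallel i k -> P k) -> (forall k, parallel j k -> P k) ->
  2 <= \sum_(k | P k) c k.
Proof.
move=> hij Pind Pi Pj; have [hi hj] := ind2_nonloop hij.
rewrite (bigID (parallel i)) /= (eq_bigl (parallel i)); last first.
  by move=> k; rewrite andb_idl //; apply: Pi.
rewrite sum_class_weight // (bigID (parallel j)) /=.
rewrite (eq_bigl (parallel j)); last first.
  move=> k; apply/andP/idP => [[]//|jk]; split=> //; rewrite Pj //=.
  apply: contraL hij => ik.
  have : parallel i j by apply: parallel_trans ik _; rewrite parallelC.
  by case/and3P.
rewrite sum_class_weight // addrA lerDl; apply: sumr_ge0 => k /andP[/andP[]].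
by move=> /Pind /class_weight_gt0 /ltW.
Qed.

Lemma sum_class_weight_le_card :
  \sum_(k | ind [:: k]) c k <= #|[pred k | ind [:: k]]|%:R.
Proof.
rewrite -sumr_const; apply: ler_sum => k hk; exact: class_weight_le1.
Qed.

Lemma sum_ind2 x i : ind [:: i] ->
  \sum_(j | ind [:: i; j]) x j = \sum_(j | ind [:: j]) x j - class_sum x i.
Proof.
move=> hi; rewrite [X in _ = X - _](bigID (parallel i)) /=.
rewrite [X in _ = X + _ - _](eq_bigl (parallel i)) => [|j]; last first.
  by rewrite andb_idl // => /and3P[].
rewrite /class_sum addrAC subrr add0r; apply: eq_bigl => j; rewrite /parallel hi.
apply/idP/andP => [ij|[-> /=]]; last by rewrite negbK.
by rewrite ij andbF; split=> //; apply: ind_behead ij.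
Qed.

(** Independent pairs are the pairs of nonloops in different classes, so the form is the full
    product minus its part inside the classes. *)
Lemma sum_sum_ind2 x y :
  \sum_i x i * \sum_(j | ind [:: i; j]) y j
  = (\sum_(i | ind [:: i]) x i) * (\sum_(i | ind [:: i]) y i)
    - \sum_(i | ind [:: i]) c i * class_sum x i * class_sum y i.
Proof.
rewrite -(sum_classes _ (class_sum_parallel y)).
rewrite (bigID (fun i => ind [:: i])) /= [X in _ + X]big1 ?addr0; last first.
  move=> i ni; rewrite big1 ?mulr0 // => j /ind2_nonloop[hi].
  by rewrite hi in ni.
rewrite mulr_suml -sumrB; apply: eq_bigr => i hi.
by rewrite sum_ind2 // mulrBr.
Qed.

(** * The quadratic form of a rank 2 contraction, and counting classes on a line *)

Section Rank2.
Variables (i0 j0 : 'I_n) (N : R).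
Hypothesis hij0 : ind [:: i0; j0].
Hypothesis leN : #|[pred k | ind [:: k]]|%:R <= N.

(** The number of parallel classes. In the applications [N] is [n - size t] for the contraction by
    [t]. *)
Let p := \sum_(k | ind [:: k]) c k.
Let p_ge2 : 2 <= p.
Proof. by apply: (sum_class_weight_ge2 hij0) => // k /and3P[]. Qed.
Let p_leN : p <= N.
Proof. exact: le_trans sum_class_weight_le_card leN. Qed.

(* With t = (N - 1) b0 + s, the quadratic form is
   t^2 + (t - s)^2 / (N - 1) - \sum c_i y_i^2, and the linear condition makes t
   the mean of the class sums y_i for the weights c_i A_i / S. Jensen for these
   weights and for the complementary weights c_i (1 - A_i / S) bounds it. *)
Lemma rank2_form_le0 (a b : 'I_n -> R) (b0 : R) (a_gt0 : forall i, 0 < a i) :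
  let s := \sum_(i | ind [:: i]) b i in
  (N - 1) * b0 * (\sum_(i | ind [:: i]) a i)
    + \sum_i b i * \sum_(j | ind [:: i; j]) a j = 0 ->
  let q := N * (N - 1) * b0 ^+ 2 + 2 * (N - 1) * b0 * s
    + \sum_i b i * \sum_(j | ind [:: i; j]) b j in
  q <= 0 /\ (q = 0 -> N * b0 + s = 0 /\
    forall i, ind [:: i] -> (N - 1) * b0 + \sum_(j | ind [:: i; j]) b j = 0).
Proof.
move=> s; rewrite !sum_sum_ind2 -/s.
set S := \sum_(i | ind [:: i]) a i => h q.
have [hi0 hj0] := ind2_nonloop hij0.
have N1 : 0 < N - 1 by move: p_ge2 p_leN; lra.
have p1 : 0 < p - 1 by move: p_ge2; lra.
have S0 : 0 < S.
  rewrite /S (bigD1 i0) //= ltr_pwDl ?a_gt0 // sumr_ge0 // => i _.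
  exact/ltW/a_gt0.
pose t := (N - 1) * b0 + s.
pose al i := class_sum a i / S.
pose y := class_sum b.
have al_gt0 i : ind [:: i] -> 0 < al i.
  move=> hi; rewrite divr_gt0 // /class_sum (bigD1 i) ?parallelxx //=.
  by rewrite ltr_pwDl ?a_gt0 // sumr_ge0 // => j _; exact/ltW/a_gt0.
have al_le1 i : ind [:: i] -> al i <= 1.
  move=> hi; rewrite ler_pdivrMr // mul1r /S (bigID (parallel i)) /=.
  rewrite (eq_bigl (parallel i)) => [|j]; last first.
    by rewrite andb_idl // => /and3P[].
  by rewrite lerDl sumr_ge0 // => j _; exact/ltW/a_gt0.
have sum_al : \sum_(i | ind [:: i]) c i * al i = 1.
  have := @sum_classes a (fun=> 1) (fun _ _ _ => erefl).
  under eq_bigr do rewrite mulr1.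
  under [in X in _ = X -> _]eq_bigr do rewrite mulr1.
  rewrite -/S => SE; under eq_bigr do rewrite /al mulrA.
  by rewrite -mulr_suml -SE divff // gt_eqF.
have sum_al' : \sum_(i | ind [:: i]) c i * (1 - al i) = p - 1.
  by under eq_bigr do rewrite mulrBr mulr1; rewrite sumrB sum_al.
have sE : s = \sum_(i | ind [:: i]) c i * y i.
  have := @sum_classes b (fun=> 1) (fun _ _ _ => erefl).
  under eq_bigr do rewrite mulr1.
  by under [in X in _ = X -> _]eq_bigr do rewrite mulr1.
have tE : \sum_(i | ind [:: i]) c i * al i * y i = t.
  apply: (mulIf (lt0r_neq0 S0)); rewrite mulr_suml.
  rewrite (eq_bigr (fun i => c i * class_sum b i * class_sum a i)); last first.
    by move=> i _; rewrite /al /y; field; rewrite gt_eqF.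
  by rewrite /t; lra.
have tE' : \sum_(i | ind [:: i]) c i * (1 - al i) * y i = s - t.
  by under eq_bigr do rewrite mulrBr mulr1 mulrBl; rewrite sumrB -sE tE.
have := @sum_sqr_mean R _ (fun i => ind [:: i]) (fun i => c i * al i) y.
rewrite sum_al tE !divr1 => /(_ ltr01) /=; set V := (X in _ = _ + X) => J1.
have := @sum_sqr_mean R _ (fun i => ind [:: i]) (fun i => c i * (1 - al i)) y.
rewrite sum_al' tE' => /(_ p1) /=; set V' := (X in _ = _ + X) => J2.
have V0 : 0 <= V.
  apply: sumr_ge0 => i hi; rewrite mulr_ge0 ?sqr_ge0 // ltW //.
  by rewrite mulr_gt0 ?class_weight_gt0 ?al_gt0.
have V'0 : 0 <= V'.
  apply: sumr_ge0 => i hi; rewrite mulr_ge0 ?sqr_ge0 //.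
  by rewrite mulr_ge0 ?subr_ge0 ?al_le1 // ltW ?class_weight_gt0.
have qE : q = t ^+ 2 + (s - t) ^+ 2 / (N - 1)
              - \sum_(i | ind [:: i]) c i * y i * y i.
  by rewrite /q /t; field; rewrite gt_eqF.
have yyE : \sum_(i | ind [:: i]) c i * y i * y i
    = (t ^+ 2 + V) + ((s - t) ^+ 2 / (p - 1) + V').
  rewrite -J1 -J2 -big_split; apply: eq_bigr => i _ /=; ring.
(* Besides the two variances there remains the gap between [p - 1] and [N - 1], nonnegative since
   [p <= N]. *)
set u := (s - t) ^+ 2 * ((p - 1)^-1 - (N - 1)^-1).
have u0 : 0 <= u.
  by rewrite mulr_ge0 ?sqr_ge0 // subr_ge0 lef_pV2 ?posrE // lerD2r.
have {}qE : q = - (V + V' + u) by rewrite qE yyE /u; ring.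
split=> [|q0]; first by rewrite qE oppr_le0; lra.
have [VE uE] : V = 0 /\ u = 0 by split; lra.
have yt i : ind [:: i] -> y i = t.
  move=> hi; move/eqP: VE; rewrite psumr_eq0 => [|j hj]; last first.
    rewrite mulr_ge0 ?sqr_ge0 // ltW //.
    by rewrite mulr_gt0 ?class_weight_gt0 ?al_gt0.
  move/allP/(_ i (mem_index_enum _)); rewrite hi /= mulf_eq0 sqrf_eq0 subr_eq0.
  by rewrite (gt_eqF (mulr_gt0 (class_weight_gt0 hi) (al_gt0 i hi))) => /eqP.
split; last first.
  by move=> i hi; rewrite sum_ind2 // -/y -/s yt // /t; lra.
have {}sE : s = p * t.
  by rewrite sE mulr_suml; apply: eq_bigr => i hi; rewrite yt.
have b0E : (N - 1) * b0 = t - s by rewrite /t; ring.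
(* Either [s = t], and then [p >= 2] forces [b0 = t = 0], or [p = N], and then [b0 = - t]. *)
move/eqP: uE; rewrite mulf_eq0 sqrf_eq0 !subr_eq0 => /orP[/eqP st|/eqP pN].
  have b00 : b0 = 0.
    by apply/eqP; move/eqP: b0E; rewrite st subrr mulf_eq0 gt_eqF.
  have : (p - 1) * t = 0 by rewrite mulrBl mul1r -sE st subrr.
  move/eqP; rewrite mulf_eq0 gt_eqF //= => /eqP t0.
  by rewrite b00 st t0; lra.
move/invr_inj: pN => pN; have {}pN : p = N by lra.
have : (N - 1) * (b0 + t) = 0 by rewrite mulrDr b0E sE pN; ring.
move/eqP; rewrite mulf_eq0 gt_eqF //= => /eqP; rewrite sE pN; nra.
Qed.

(** All class sums equal one value [be]. If the line through [i0] and [j0] has [m >= 2] classes, the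
    second equation gives [b0 = - (m - 1) * be], hence [p = 1 + (N - 1) * (m - 1)] unless [be = 0].
    Now [p <= N] forces [m = 2] and [p = N], where the claim is an identity. *)
Lemma rank3_kernel (b : 'I_n -> R) (b0 : R) :
  (forall i, ind [:: i] ->
     (N - 1) * b0 + \sum_(j | ind [:: i; j]) b j = 0) ->
  (N - 2) * b0 + \sum_(k | ind [:: k; i0; j0]) b k = 0 ->
  N * b0 + \sum_(i | ind [:: i]) b i = 0.
Proof.
set s := \sum_(i | ind [:: i]) b i => h1 h2.
pose be := (N - 1) * b0 + s.
have yE i : ind [:: i] -> class_sum b i = be.
  by move=> hi; have := h1 i hi; rewrite sum_ind2 // -/s /be; lra.
have sE : s = p * be.
  have := @sum_classes b (fun=> 1) (fun _ _ _ => erefl).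
  under eq_bigr do rewrite mulr1; rewrite -/s => ->; rewrite mulr_suml.
  by apply: eq_bigr => i hi; rewrite yE // mulr1.
(* The nonloops on the line spanned by [i0] and [j0]; these two belong to it because lists with
   repetitions are dependent. *)
pose C k := ind [:: k] && ~~ ind [:: k; i0; j0].
pose m := \sum_(k | C k) c k.
have CP k l : parallel k l -> C k = C l.
  move=> kl; have /and3P[hk hl _] := kl; rewrite /C hk hl; congr (~~ _).
  by apply/idP/idP; apply: parallel_ind3; rewrite // parallelC.
have [hi0 hj0] := ind2_nonloop hij0.
have Ci k : parallel i0 k -> C k.
  move/CP <-; rewrite /C hi0; apply/negP => /ind_uniq.
  by rewrite /= inE eqxx.
have Cj k : parallel j0 k -> C k.
  move/CP <-; rewrite /C hj0; apply/negP => /ind_uniq.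
  by rewrite /= !inE eqxx orbT.
have m2 : 2 <= m by apply: (sum_class_weight_ge2 hij0) => // k /andP[].
have CE : \sum_(k | C k) b k = m * be.
  have Cinv k l : parallel k l -> (C k)%:R = (C l)%:R :> R by move=> /CP ->.
  have := sum_classes b Cinv.
  have CI (x : 'I_n -> R) :
      \sum_(k | ind [:: k]) x k * (C k)%:R = \sum_(k | C k) x k.
    rewrite (bigID C) /= [X in _ + X]big1 ?addr0 => [|k /andP[_ /negPf->]]; last first.
      by rewrite mulr0.
    rewrite (eq_bigl C) => [|k]; last by rewrite /C andbA andbb.
    by apply: eq_bigr => k ->; rewrite mulr1.
  rewrite !CI => ->; rewrite mulr_suml; apply: eq_bigr => k /andP[hk _].
  by rewrite yE.
have sC : s = \sum_(k | ind [:: k; i0; j0]) b k + m * be.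
  rewrite -CE /s (bigID (fun k => ind [:: k; i0; j0])) /=; congr (_ + _).
  apply: eq_bigl => k; rewrite andb_idl // => h.
  apply: (ind_sub _ _ h) => // x; rewrite !inE => ->; by [].
have b0E : b0 = - (m - 1) * be.
  by move: h2 sC; rewrite /be; lra.
have [be0|be0] := eqVneq be 0.
  by rewrite sE b0E be0; lra.
have pE : p = 1 + (N - 1) * (m - 1).
  apply: (mulIf be0); rewrite -sE; have : be = (N - 1) * b0 + s by [].
  by rewrite b0E; lra.
have N1 : 0 < N - 1 by move: p_ge2 p_leN; lra.
have m2' : m = 2.
  apply/eqP; rewrite eq_le m2 andbT.
  have : (N - 1) * (m - 1) <= (N - 1) * 1 by move: p_leN; lra.
  by rewrite ler_pM2l //; lra.
by rewrite sE pE b0E m2'; ring.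
Qed.

End Rank2.
End IndependentSequences.

(** * The functional dual to the polynomial *)

Section DualFunctional.
Variables (R : realFieldType) (k : nat) (g : {mpoly R[k]}).
Implicit Types D E : {mpoly R[k]}.

(** The degree map of the quotient, lifted to all operators. *)
Definition dual_value D : R := (diffop D g)@_0%MM.
Local Notation phi := dual_value.

Lemma dual_valueD D E : phi (D + E) = phi D + phi E.
Proof. by rewrite /phi diffopD mcoeffD. Qed.

Lemma dual_valueZ c D : phi (c *: D) = c * phi D.
Proof. by rewrite /phi diffopZ mcoeffZ. Qed.

Lemma dual_value0 : phi 0 = 0.
Proof. by rewrite /phi diffop0 mcoeff0. Qed.

Lemma dual_value_sum (I : Type) (s : seq I) (P : pred I) (F : I -> {mpoly R[k]}) :
  phi (\sum_(i <- s | P i) F i) = \sum_(i <- s | P i) phi (F i).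
Proof. by apply: big_morph; [exact: dual_valueD | exact: dual_value0]. Qed.

Lemma dual_value_monomials D :
  (forall m, phi (D * 'X_[m]) = 0) -> forall E, phi (D * E) = 0.
Proof.
move=> h E; rewrite [E]mpolyE mulr_sumr dual_value_sum big1 // => m _.
by rewrite -scalerAr dual_valueZ h mulr0.
Qed.

(** Up to a nonzero factorial, the coefficient of [diffop D g] at [m] is [phi (D * 'X_[m])]; so the
    annihilator is the radical of the pairing. *)
Lemma annihilatorP D :
  reflect (forall E, phi (D * E) = 0) (D \in annihilator g).
Proof.
rewrite unfold_in; apply: (iffP eqP) => [Dg0 E|h].
  by rewrite /phi mulrC diffopM Dg0 diffopr0 mcoeff0.
apply/mpolyP => m; rewrite mcoeff0; apply/eqP; have := h 'X_[m].
rewrite /phi mulrC diffopM diffopX mcoeff_mderivm addm0 => /eqP.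
rewrite mulrn_eq0 gtn_eqF // prodn_gt0 // => i.
by rewrite ffactnn fact_gt0.
Qed.

End DualFunctional.

(** * Values of the dual functional of the reduced independence polynomial *)

Section IndependencePolynomial.
Variables (R : realFieldType) (n : nat) (M : matroid n).

Local Notation r := (rank M).
Local Notation phi := (dual_value (reduced_indep_poly R M)).
Local Notation x0 := ('X_ord0 : {mpoly R[n.+1]}).
Local Notation X i := ('X_(lift ord0 i) : {mpoly R[n.+1]}).
Local Notation ind := (indep_seq M).
Local Notation D t := (\prod_(i <- t) X i).
Implicit Types (t s : seq 'I_n) (E : {mpoly R[n.+1]}).

Let ind_uniq t : ind t -> uniq t.
Proof. by case/andP. Qed.

(** The exponent of the term of [I] in [indep_poly]. *)
Definition set_mnm (I : {set 'I_n}) : 'X_{1..n.+1} :=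
  (\sum_(i in I) U_(lift ord0 i) + U_(ord0) *+ (n - #|I|))%MM.

Lemma set_mnm0 I : set_mnm I ord0 = (n - #|I|)%N.
Proof.
rewrite /set_mnm mnmDE mnm_sumE mulmnE mnm1E eqxx mul1n big1 ?add0n // => i _.
by rewrite mnm1E.
Qed.

Lemma set_mnm_lift I j : set_mnm I (lift ord0 j) = (j \in I).
Proof.
rewrite /set_mnm mnmDE mnm_sumE mulmnE mnm1E mul0n addn0.
under eq_bigr do rewrite mnm1E (inj_eq lift_inj).
have [jI|jI] := boolP (j \in I).
  by rewrite (bigD1 j) //= eqxx big1 ?addn0 // => i /andP[_ /negPf->].
by rewrite big1 // => i iI; case: eqP => // ij; rewrite -ij iI in jI.
Qed.

Lemma mdeg_set_mnm I : mdeg (set_mnm I) = n.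
Proof.
have leI : (#|I| <= n)%N by rewrite -[n in (_ <= n)%N]card_ord max_card.
rewrite /set_mnm mdegD mdegMn mdeg1 mul1n mdeg_sum.
under eq_bigr do rewrite mdeg1.
by rewrite sum1_card subnKC.
Qed.

Lemma prod_var t : D t = 'X_[\sum_(i <- t) U_(lift ord0 i)].
Proof. by rewrite mprodXE. Qed.

(** The [n - r] derivatives along [x0] are moved into the operator. Only a term with the resulting
    exponent has a nonzero constant coefficient, and the ground variables, with exponents at most 1,
    add nothing to the factorial. *)
Lemma dual_valueX (m : 'X_{1..n.+1}) :
  phi 'X_[m] = \sum_(I in indep M)
    if set_mnm I == (m + U_(ord0) *+ (n - r))%MM then (n - #|I|)`!%:R else 0.
Proof.
rewrite /phi diffopX /reduced_indep_poly -mderivmDm mcoeff_mderivm addm0 addmC.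
set q := (m + _)%MM.
have -> : indep_poly R M = \sum_(I in indep M) 'X_[set_mnm I].
  apply: eq_bigr => I _.
  by rewrite /set_mnm mpolyXD -mprodXE -mpolyXn.
rewrite raddf_sum -mulr_natr mulr_suml; apply: eq_bigr => I _ /=.
rewrite mcoeffX; case: eqP => [qE|_]; last by rewrite mul0r.
rewrite mul1r; congr (_%:R); under eq_bigr do rewrite ffactnn.
rewrite big_ord_recl -qE set_mnm0 big1 ?muln1 // => i _.
by rewrite set_mnm_lift; case: (_ \in _).
Qed.

Lemma dual_value_homog E d : E \is d.-homog -> d != r -> phi E = 0.
Proof.
move=> /dhomogP hE dr; rewrite [E]mpolyE dual_value_sum big_seq big1 // => m mE.
rewrite dual_valueZ dual_valueX big1 ?mulr0 // => I _; case: eqP => // hm.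
have := congr1 (@mdeg _) hm; rewrite mdeg_set_mnm mdegD mdegMn mdeg1 mul1n.
have /= := hE _ mE; rewrite /= => -> /eqP; have := rank_le M.
by move: dr => /eqP; lia.
Qed.

(** A contributing term of [I] would contain every entry of [t], each only once since ground
    variables have exponent at most 1; then [t] would be independent. *)
Lemma dual_value_dep t E : ~~ ind t -> phi (D t * E) = 0.
Proof.
move=> nt; move: E; apply: dual_value_monomials => m.
rewrite prod_var -mpolyXD dual_valueX big1 // => I hI; case: eqP => // hm.
have mE j : (j \in I) = (count_mem j t + m (lift ord0 j))%N :> nat.
  rewrite -set_mnm_lift hm mnmDE mnmDE mulmnE mnm1E mul0n addn0 mnm_sumE.
  congr (_ + _)%N; rewrite -sum1_count [RHS]big_mkcond /=; apply: eq_bigr => i _.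
  by rewrite mnm1E (inj_eq lift_inj); case: (_ == _).
case/negP: nt; apply/andP; split.
  apply: count_mem_uniq => j; have := mE j.
  rewrite -has_pred1 has_count.
  by case: (j \in I); case: (count_mem j t) => [|[|c]] //=; lia.
apply: indepS hI; apply/subsetP => j; rewrite inE -has_pred1 has_count => jt.
by have := mE j; case: (j \in I) => // /esym/eqP; rewrite addn_eq0 eqn0Ngt jt.
Qed.

(** The exponents of the ground variables determine the set, so only the term of the set of [t]
    contributes. *)
Lemma dual_value_indep t e : ind t -> (size t + e)%N = r ->
  phi (D t * x0 ^+ e) = (n - size t)`!%:R.
Proof.
move=> ht te; rewrite prod_var mpolyXn -mpolyXD dual_valueX.
have /andP[ut hI] := ht; set I := [set x in t] in hI.
have cI : #|I| = size t by rewrite cardsE; apply/card_uniqP.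
have hm : (\sum_(i <- t) U_(lift ord0 i) + U_(ord0) *+ e + U_(ord0) *+ (n - r))%MM
    = set_mnm I.
  rewrite /set_mnm -addmA; congr (_ + _)%MM.
    rewrite big_uniq //=; apply: eq_bigl => i; by rewrite inE.
  apply/mnmP => i; rewrite mnmDE !mulmnE -mulnDr cI; congr (_ * _)%N.
  by have := rank_le M; lia.
rewrite hm (bigD1 I) //= eqxx cI big1 ?addr0 // => J /andP[_ JI].
case: eqP => // JE; case/negP: JI; apply/eqP/setP => j.
have := congr1 (fun m : 'X_{1..n.+1} => m (lift ord0 j)) JE.
by rewrite /= !set_mnm_lift; do 2!case: (_ \in _).
Qed.

Lemma prod_var_homog t : D t \is (size t).-homog.
Proof.
rewrite prod_var dhomogX /= mdeg_sum; under eq_bigr do rewrite mdeg1.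
by rewrite sum1_size.
Qed.

Lemma prod_var_cons i t E : D (i :: t) * E = D t * (X i * E).
Proof. by rewrite big_cons; ring. Qed.

Lemma dual_value_prod_var t e : (size t + e)%N = r ->
  phi (D t * x0 ^+ e) = if ind t then (n - size t)`!%:R else 0.
Proof.
by move=> te; case: ifP => [/dual_value_indep->//|/negbT/dual_value_dep].
Qed.

Definition linear_form (b0 : R) (b : 'I_n -> R) : {mpoly R[n.+1]} :=
  b0 *: x0 + \sum_i b i *: X i.

Lemma lin_homog b0 b : linear_form b0 b \is 1.-homog.
Proof.
have hX i : ('X_i : {mpoly R[n.+1]}) \is 1.-homog by rewrite dhomogX /= mdeg1.
apply: rpredD; first exact/rpredZ/hX.
by apply: rpred_sum => i _; apply/rpredZ/hX.
Qed.

Lemma linD b0 b c0 c :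
  linear_form b0 b + linear_form c0 c = linear_form (b0 + c0) (fun i => b i + c i).
Proof.
rewrite /linear_form addrACA -scalerDl -big_split /=; congr (_ + _).
by apply: eq_bigr => i _; rewrite scalerDl.
Qed.

Lemma linZ z b0 b : z *: linear_form b0 b = linear_form (z * b0) (fun i => z * b i).
Proof.
rewrite /linear_form scalerDr scalerA scaler_sumr; congr (_ + _).
by apply: eq_bigr => i _; rewrite scalerA.
Qed.

Lemma homog1_lin E : E \is 1.-homog -> exists b0 b, E = linear_form b0 b.
Proof.
move=> /dhomogP hE; exists (E@_U_(ord0)), (fun i => E@_U_(lift ord0 i)).
have -> : linear_form E@_U_(ord0) (fun i => E@_U_(lift ord0 i))
    = \sum_i E@_U_(i) *: 'X_i.
  by rewrite big_ord_recl.
apply/mpolyP => m; rewrite raddf_sum /=.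
under eq_bigr do rewrite mcoeffZ mcoeffX.
have [/mdeg1P[i /eqP->]|m1] := boolP (mdeg m == 1%N).
  rewrite (bigD1 i) //= eqxx mulr1 big1 ?addr0 // => j ji.
  by rewrite eq_mnm1 (negPf ji) mulr0.
rewrite big1 => [|j _]; last first.
  by case: eqP => [jm|_]; rewrite ?mulr0 //; move: m1; rewrite -jm mdeg1.
by apply/eqP; apply: contraNT m1; rewrite -mcoeff_msupp => /hE /= ->.
Qed.

Lemma dual_value_lin t b0 b E : phi (D t * linear_form b0 b * E)
  = b0 * phi (D t * (x0 * E)) + \sum_i b i * phi (D (i :: t) * E).
Proof.
rewrite /linear_form mulrDr mulrDl dual_valueD; congr (_ + _).
  by rewrite -scalerAr -scalerAl dual_valueZ mulrA.
rewrite mulr_sumr mulr_suml dual_value_sum; apply: eq_bigr => i _.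
by rewrite -scalerAr -scalerAl dual_valueZ -mulrA prod_var_cons.
Qed.

Lemma indep_basis : exists2 s, ind s & size s = r.
Proof.
have [I hI cI] : {I | I \in indep M & rank M = #|I|}.
  by apply: eq_bigmax_cond; apply/card_gt0P; exists set0; apply: indep0.
exists (enum I); last by rewrite -cardE.
rewrite /indep_seq enum_uniq; suff -> : [set x in enum I] = I by [].
by apply/setP => x; rewrite inE mem_enum.
Qed.

Lemma indep_extend t : ind t -> (size t < r)%N -> exists i, ind (i :: t).
Proof.
have [s hs <-] := indep_basis; have [_ _ aug] := indep_seq_axioms M.
by move=> ht lt; have [i _ hi] := aug _ _ ht hs lt; exists i.
Qed.

(** Nonloops of the contraction avoid [t]; this supplies the bound by [N] used for the rank 2
    form. *)
Lemma card_nonloops t : ind t ->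
  (#|[pred i | ind [:: i & t]]| <= n - size t)%N.
Proof.
move=> /ind_uniq /card_uniqP <-.
have := cardC (mem t); rewrite card_ord => /(congr1 (fun k => k - #|t|)%N).
rewrite /= addKn => <-; apply: subset_leq_card.
by apply/subsetP => i; rewrite !inE => /ind_uniq /= /andP[].
Qed.

(** * Hodge-Riemann relations for the derivatives of the polynomial *)

Section Positive.
Variable a : 'I_n -> R.
Hypothesis a_gt0 : forall i, 0 < a i.
Local Notation l := (ell_form a).

Lemma ell_formE : l = linear_form 0 a.
Proof. by rewrite /linear_form scale0r add0r. Qed.

Lemma dual_value_ell t E :
  phi (D t * l * E) = \sum_i a i * phi (D (i :: t) * E).
Proof. by rewrite ell_formE dual_value_lin mul0r add0r. Qed.

Lemma dual_value_ell_exp t E k :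
  phi (D t * E * l ^+ k.+1) = \sum_i a i * phi (D (i :: t) * E * l ^+ k).
Proof.
rewrite (_ : _ * _ = D t * l * (E * l ^+ k)); last by rewrite exprS; ring.
by rewrite dual_value_ell; apply: eq_bigr => i _; rewrite mulrA.
Qed.

Lemma dual_value_ge0 t k : 0 <= phi (D t * l ^+ k).
Proof.
elim: k t => [|k IH] t; last first.
  rewrite exprS mulrA dual_value_ell sumr_ge0 // => i _.
  by rewrite mulr_ge0 // ltW.
have [tr|tr] := eqVneq (size t) r.
  have := @dual_value_prod_var t 0; rewrite addn0 => /(_ tr).
  by rewrite !expr0 => ->; case: ifP => // _; apply: ler0n.
by rewrite expr0 mulr1 (dual_value_homog (prod_var_homog t)).
Qed.

(** Expanding [l] gives nonnegative terms, and one of them is positive because [t] extends to a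
    basis. *)
Lemma dual_value_gt0 t k : ind t -> (size t + k)%N = r ->
  0 < phi (D t * l ^+ k).
Proof.
elim: k t => [|k IH] t ht tk.
  by have := dual_value_indep ht tk; rewrite !expr0 => ->; rewrite ltr0n fact_gt0.
have [|i hi] := indep_extend ht; first by rewrite -tk addnS ltnS leq_addr.
rewrite exprS mulrA dual_value_ell (bigD1 i) //= ltr_pwDl //.
  by rewrite mulr_gt0 // IH //= addSnnS.
by apply: sumr_ge0 => j _; rewrite mulr_ge0 ?dual_value_ge0 // ltW.
Qed.

(* Hodge-Riemann in degree one for the derivative of the polynomial along t,
   stated before passing to the quotient by the annihilator. *)
Definition hodge_riemann_at k t := forall b0 b,
  phi (D t * linear_form b0 b * l ^+ k.+1) = 0 ->
  phi (D t * linear_form b0 b ^+ 2 * l ^+ k) <= 0 /\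
  (phi (D t * linear_form b0 b ^+ 2 * l ^+ k) = 0 ->
   forall E, phi (D t * linear_form b0 b * E) = 0).

Lemma kernel_monomials t b0 b k : (size t + k.+1)%N = r ->
  (forall m, mdeg m = k -> phi (D t * linear_form b0 b * 'X_[m]) = 0) ->
  forall E, phi (D t * linear_form b0 b * E) = 0.
Proof.
move=> tk h; apply: dual_value_monomials => m.
have [/h//|mk] := eqVneq (mdeg m) k.
apply: (@dual_value_homog _ (size t + 1 + mdeg m)%N); last first.
  by rewrite -tk -addnA eqn_add2l add1n eqSS.
apply: dhomogM; last by rewrite dhomogX.
apply: dhomogM; [exact: prod_var_homog | exact: lin_homog].
Qed.

(** With [n - size t = m.+2], the values on independent monomials are the factorials of [m.+2],
    [m.+1] and [m], according to the power of [x0]. Dividing by the last one gives the form of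
    [rank2_form_le0] with [N = m.+2]. *)
Lemma hodge_riemann_rank2 t : ind t -> (size t + 2)%N = r -> hodge_riemann_at 0 t.
Proof.
move=> ht t2 b0 b.
have [m nE] : exists m, (n - size t)%N = m.+2.
  by exists (n - size t - 2)%N; have := rank_le M; lia.
have ax := indep_axioms_contract t (indep_seq_axioms M).
have [i hi] : exists i, ind (i :: t) by apply: indep_extend => //; lia.
have [j hj] : exists j, ind (j :: i :: t) by apply: indep_extend => //=; lia.
set ind' := (fun s => ind (s ++ t)) in ax.
have hij : ind' [:: j; i] by [].
have leN : #|[pred k | ind' [:: k]]|%:R <= (m.+2%:R : R).
  by rewrite ler_nat; have := card_nonloops ht; rewrite nE.
have f1 : (m.+1)`!%:R = m.+1%:R * m`!%:R :> R by rewrite factS natrM.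
have f2 : (m.+2)`!%:R = m.+2%:R * (m.+1%:R * m`!%:R) :> R.
  by rewrite factS natrM f1.
have f0 : 0 < m`!%:R :> R by rewrite ltr0n fact_gt0.
have N1 : m.+2%:R - 1 = m.+1%:R :> R by rewrite -[m.+2%:R]natr1 addrK.
have v0 : phi (D t * x0 ^+ 2) = m.+2%:R * (m.+1%:R * m`!%:R).
  by rewrite dual_value_prod_var // ht nE f2.
have v1 k : phi (D (k :: t) * x0) = if ind' [:: k] then m.+1%:R * m`!%:R else 0.
  have := @dual_value_prod_var (k :: t) 1; rewrite expr1 => -> /=; last by lia.
  by rewrite subnS nE f1.
have v2 k k' : phi (D (k' :: k :: t)) = if ind' [:: k; k'] then m`!%:R else 0.
  have := @dual_value_prod_var (k' :: k :: t) 0; rewrite expr0 mulr1 => -> /=.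
    rewrite !subnS nE; congr (if _ then _ else _).
    exact: (ind2C ax).
  by lia.
have bil (c0 d0 : R) (c d : 'I_n -> R) :
    phi (D t * linear_form c0 c * linear_form d0 d)
    = (m.+2%:R * m.+1%:R * c0 * d0
       + m.+1%:R * (c0 * (\sum_(k | ind' [:: k]) d k)
                    + d0 * (\sum_(k | ind' [:: k]) c k))
       + \sum_k c k * \sum_(k' | ind' [:: k; k']) d k') * m`!%:R.
  rewrite dual_value_lin.
  have -> : D t * (x0 * linear_form d0 d) = D t * linear_form d0 d * x0 by ring.
  rewrite dual_value_lin -expr2 v0 (eq_bigr _ (fun k _ => congr1 _ (v1 k))).
  have sv1 (e : 'I_n -> R) :
      \sum_k e k * (if ind' [:: k] then m.+1%:R * m`!%:R else 0)
      = (\sum_(k | ind' [:: k]) e k) * (m.+1%:R * m`!%:R).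
    rewrite [in RHS]big_mkcond mulr_suml; apply: eq_bigr => k _.
    by case: ifP; rewrite ?mul0r ?mulr0.
  rewrite sv1.
  rewrite [Y in _ + Y = _](eq_bigr (fun k =>
      d0 * (c k * (if ind' [:: k] then m.+1%:R * m`!%:R else 0))
      + (c k * \sum_(k' | ind' [:: k; k']) d k') * m`!%:R)); last first.
    move=> k _; have := dual_value_lin (k :: t) d0 d 1; rewrite !mulr1 => ->.
    rewrite v1 mulrDr; congr (_ + _); first by ring.
    rewrite -mulrA; congr (_ * _); rewrite [in RHS]big_mkcond mulr_suml.
    apply: eq_bigr => k' _; rewrite mulr1 v2.
    by case: ifP; rewrite ?mul0r ?mulr0.
  rewrite big_split /= -mulr_sumr sv1 -mulr_suml; ring.
rewrite expr1 expr0 mulr1 expr2 mulrA ell_formE !bil => /eqP.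
rewrite mulf_eq0 (gt_eqF f0) orbF => /eqP h.
have [|q0 qE] := @rank2_form_le0 _ ind' ax R j i m.+2%:R hij leN a b b0 a_gt0.
  by rewrite N1 -[RHS]h; ring.
rewrite N1 in q0 qE; split.
  rewrite pmulr_lle0 //; apply: le_trans q0; rewrite le_eqVlt; apply/orP; left.
  by apply/eqP; ring.
move/eqP; rewrite mulf_eq0 (gt_eqF f0) orbF => /eqP q.
case: qE => [|k0 k1]; first by rewrite -[RHS]q; ring.
(* It remains to test against single variables: [k1] settles the nonloops, loops give 0, and [k0]
   settles [x0]. *)
apply: (@kernel_monomials t b0 b 1) => // m' /eqP /mdeg1P[k /eqP ->].
have [k' ->|->] := unliftP ord0 k.
  rewrite mulrAC -(mulr1 (_ * linear_form _ _)).
  have -> : D t * X k' * linear_form b0 b * 1 = D (k' :: t) * linear_form b0 b * 1.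
    by rewrite -!mulrA prod_var_cons.
  rewrite dual_value_lin !mulr1 v1.
  have [hk'|nk'] := boolP (ind' [:: k']); last first.
    rewrite mulr0 add0r big1 // => k2 _; rewrite mulr1 v2.
    by case: ifP => [/(ind2_nonloop ax)[]|]; rewrite ?(negPf nk') ?mulr0.
  transitivity ((m.+1%:R * b0 + \sum_(j | ind' [:: k'; j]) b j) * m`!%:R).
    rewrite [RHS]mulrDl; congr (_ + _); first by ring.
    rewrite [in RHS]big_mkcond mulr_suml; apply: eq_bigr => k2 _.
    by rewrite mulr1 v2; case: ifP; rewrite ?mul0r ?mulr0.
  by rewrite k1 // mul0r.
rewrite dual_value_lin -expr2 v0.
transitivity ((m.+2%:R * b0 + \sum_(k | ind' [:: k]) b k) * (m.+1%:R * m`!%:R)).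
  rewrite [RHS]mulrDl; congr (_ + _); first by ring.
  rewrite [in RHS]big_mkcond mulr_suml; apply: eq_bigr => k2 _.
  by rewrite v1; case: ifP; rewrite ?mul0r ?mulr0.
by rewrite k0 mul0r.
Qed.

(** * The induction step *)

Section Step.
Variables (k : nat) (t : seq 'I_n).
Hypothesis ht : ind t.
Hypothesis tk : (size t + k.+3)%N = r.
Hypothesis IH : forall i, ind (i :: t) -> hodge_riemann_at k (i :: t).

Let w i := a i * phi (D (i :: t) * l ^+ k.+2).

Lemma step_weight_gt0 i : ind (i :: t) -> 0 < w i.
Proof. by move=> hi; rewrite mulr_gt0 // dual_value_gt0 //= addSnnS. Qed.

(* The sum over i of the reversed Cauchy-Schwarz inequalities along i :: t. *)
Lemma dual_value_sqr_le b0 b : phi (D t * linear_form b0 b ^+ 2 * l ^+ k.+1)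
  <= \sum_i (a i * phi (D (i :: t) * linear_form b0 b * l ^+ k.+1)) ^+ 2 / w i.
Proof.
rewrite dual_value_ell_exp; apply: ler_sum => i _.
have [hi|ni] := boolP (ind (i :: t)); last first.
  have z E E' : phi (D (i :: t) * E * E') = 0 by rewrite -mulrA dual_value_dep.
  by rewrite !z !mulr0 expr0n mul0r.
have wi := step_weight_gt0 hi.
pose p := phi (D (i :: t) * l ^+ k.+2).
have p0 : 0 < p by rewrite dual_value_gt0 //= addSnnS.
set v := phi (D (i :: t) * linear_form b0 b * l ^+ k.+1); set q := phi _.
suff hq : q * p <= v ^+ 2.
  rewrite ler_pdivlMr // /w -/p exprMn.
  have -> : a i * q * (a i * p) = a i ^+ 2 * (q * p) by ring.
  by rewrite ler_pM2l // exprn_gt0.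
(* With this multiple of [l] added, the linear form satisfies the vanishing condition of the
   induction hypothesis. *)
pose c := - (v / p).
have linE : linear_form b0 b + c *: l
    = linear_form (b0 + c * 0) (fun j => b j + c * a j).
  by rewrite ell_formE linZ linD.
have [] := IH hi (b0 := b0 + c * 0) (b := fun j => b j + c * a j); rewrite -linE.
  rewrite mulrDr mulrDl dual_valueD -/v -scalerAr -scalerAl dual_valueZ.
  rewrite -mulrA -exprS -/p /c; field; exact: lt0r_neq0.
have -> : D (i :: t) * (linear_form b0 b + c *: l) ^+ 2 * l ^+ k
    = D (i :: t) * linear_form b0 b ^+ 2 * l ^+ k
      + (2 * c) *: (D (i :: t) * linear_form b0 b * l ^+ k.+1)
      + c ^+ 2 *: (D (i :: t) * l ^+ k.+2).
  rewrite -!mul_mpolyC (expr2 c) !mpolyCM !exprS.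
  have -> : (2 : R)%:MP_[n.+1] = 2 by rewrite mpolyC_nat.
  ring.
rewrite !dual_valueD !dual_valueZ -/p -/v -/q => hq _.
have -> : v ^+ 2 = - (2 * c * v + c ^+ 2 * p) * p.
  by rewrite /c; field; exact: lt0r_neq0.
by rewrite ler_pM2r //; lra.
Qed.

(** Monomials containing some [X i] are covered by the hypothesis, so [x0 ^+ k.+2] remains. Testing
    the hypothesis against [x0 ^+ k.+1], and against [X j * x0 ^+ k] for one independent pair,
    yields the two assumptions of [rank3_kernel], whose conclusion is the missing case. *)
Lemma kernel_step b0 b :
  (forall i E, phi (D (i :: t) * linear_form b0 b * E) = 0) ->
  forall E, phi (D t * linear_form b0 b * E) = 0.
Proof.
move=> h; apply: (@kernel_monomials t b0 b k.+2) => // m mk.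
have [i mi|m0] := pickP (fun i => m (lift ord0 i) != 0%N).
  have -> : m = (U_(lift ord0 i) + (m - U_(lift ord0 i)))%MM.
    by rewrite addmC submK // lep1mP.
  rewrite mpolyXD mulrA [D t * _ * _]mulrAC -(mulrA (D t)) -[_ * _ * _]mulrA.
  by rewrite -mulrA -prod_var_cons mulrA h.
have mE : m = (U_(ord0) *+ k.+2)%MM.
  apply/mnmP => j; rewrite mulmnE mnm1E; have [i ->|->] := unliftP ord0 j.
    by rewrite mul0n; apply/eqP/negbFE/m0.
  rewrite eqxx mul1n -mk mdegE big_ord_recl big1 ?addn0 // => i _.
  by apply/eqP/negbFE/m0.
have [q nE] : exists q, (n - size t)%N = q.+3.
  by exists (n - size t - 3)%N; have := rank_le M; lia.
have ax := indep_axioms_contract t (indep_seq_axioms M).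
have [i hi] : exists i, ind (i :: t) by apply: indep_extend => //; lia.
have [j hj] : exists j, ind (j :: i :: t) by apply: indep_extend => //=; lia.
set ind' := (fun s => ind (s ++ t)) in ax.
have hij : ind' [:: j; i] by [].
have leN : #|[pred k | ind' [:: k]]|%:R <= (q.+3%:R : R).
  by rewrite ler_nat; have := card_nonloops ht; rewrite nE.
(* Pairing with a power of [x0] leaves one linear expression in the coefficients, up to a nonzero
   factorial. *)
have val s e b0' b' : (size s + e.+1)%N = r -> ind s ->
    phi (D s * linear_form b0' b' * x0 ^+ e)
    = ((n - size s)%:R * b0' + \sum_(j | ind (j :: s)) b' j)
      * (n - size s).-1`!%:R.
  move=> se hs; rewrite dual_value_lin -exprS dual_value_prod_var // hs.
  have [N NE] : exists N, (n - size s)%N = N.+1.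
    by exists (n - size s).-1; have := rank_le M; lia.
  rewrite NE factS natrM mulrDl; congr (_ + _); first by rewrite /=; ring.
  rewrite [in RHS]big_mkcond mulr_suml; apply: eq_bigr => j' _.
  rewrite dual_value_prod_var /=; last by rewrite addSnnS.
  by rewrite subnS NE; case: ifP; rewrite ?mul0r ?mulr0.
have fN (N : nat) : N`!%:R != 0 :> R by rewrite pnatr_eq0 -lt0n fact_gt0.
have N1 : q.+3%:R - 1 = q.+2%:R :> R by rewrite -[q.+3%:R]natr1 addrK.
have N2 : q.+3%:R - 2 = q.+1%:R :> R by rewrite -[q.+3]addn2 natrD addrK.
rewrite mE -mpolyXn val // nE.
rewrite (@rank3_kernel _ ind' ax R j i q.+3%:R hij leN b b0) ?mul0r //.
  move=> i' hi'; have := h i' (x0 ^+ k.+1); rewrite val //=; last by lia.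
  rewrite subnS nE => /eqP; rewrite mulf_eq0 (negPf (fN _)) orbF => /eqP.
  by rewrite N1; under eq_bigl do rewrite -[ind _]/(ind' [:: _; _]) (ind2C ax).
have := h i (X j * x0 ^+ k).
have -> : D (i :: t) * linear_form b0 b * (X j * x0 ^+ k)
    = D (j :: i :: t) * linear_form b0 b * x0 ^+ k by rewrite !big_cons; ring.
rewrite val //=; last by lia.
rewrite !subnS nE => /eqP; rewrite mulf_eq0 (negPf (fN _)) orbF => /eqP.
by rewrite N2.
Qed.

Lemma hodge_riemann_step : hodge_riemann_at k.+1 t.
Proof.
move=> b0 b h.
pose H i j := a i * (a j * phi (D (j :: i :: t) * l ^+ k.+1)).
pose y i := a i * phi (D (i :: t) * linear_form b0 b * l ^+ k.+1).
set q := phi _.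
have Hsym i j : H i j = H j i.
  by rewrite /H mulrCA; congr (_ * (_ * phi (_ * _))); rewrite !big_cons mulrCA.
have Hge0 i j : 0 <= H i j.
  by rewrite !mulr_ge0 ?dual_value_ge0 // ltW.
have wE i : \sum_j H i j = w i.
  by rewrite /H /w -mulr_sumr [l ^+ k.+2]exprS mulrA dual_value_ell.
have wn0 i : w i != 0 -> ind (i :: t).
  apply: contraNT => ni; by rewrite /w dual_value_dep ?mulr0.
have Hgt0 i j : ind (j :: i :: t) -> 0 < H i j.
  by move=> hij; rewrite !mulr_gt0 // dual_value_gt0 //= !addSnnS.
have ax := indep_axioms_contract t (indep_seq_axioms M).
(* Nonloops without an edge between them are parallel, so a neighbour [e] of [i] is also one of [j];
   it exists because [t] is at least three elements short of a basis. *)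
have Hconn i j : \sum_j H i j != 0 -> \sum_i H j i != 0 ->
    0 < H i j \/ exists2 e, 0 < H i e & 0 < H j e.
  rewrite !wE => /wn0 hi /wn0 hj.
  have [/Hgt0|nij] := boolP (ind (j :: i :: t)); [by left | right].
  have [e he] : exists e, ind (e :: i :: t) by apply: indep_extend => //=; lia.
  exists e; apply: Hgt0 => //; apply: contraT => nej.
  have he1 : ind (e :: t) by have [] := ind2_nonloop ax (i := e) (j := i) he.
  have pij : parallel (fun s => ind (s ++ t)) i j.
    by rewrite (parallelC ax) /parallel /= hi hj nij.
  have pje : parallel (fun s => ind (s ++ t)) j e.
    by rewrite (parallelC ax) /parallel /= he1 hj nej.
  have := parallel_trans ax pij pje.
  by rewrite (parallelC ax) => /and3P[_ _]; rewrite /= he.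
have y0 i : \sum_j H i j = 0 -> y i = 0.
  rewrite wE /y; have [/step_weight_gt0/lt0r_neq0/eqP//|ni _] := boolP (ind (i :: t)).
  by rewrite -mulrA dual_value_dep ?mulr0.
have sy : \sum_i y i = 0 by rewrite -dual_value_ell_exp.
have [|q0 qy] := laplacian_form_le0 Hsym Hge0 Hconn (q := q) y0 sy.
  (* [ua] encodes [u] as a linear form; [dual_value_sqr_le] at the sum of both forms then expands to
     the required inequality. *)
  move=> u; pose ua i := u i * a i.
  have U t' E : phi (D t' * linear_form 0 ua * E)
      = \sum_i u i * (a i * phi (D (i :: t') * E)).
    by rewrite dual_value_lin mul0r add0r; apply: eq_bigr => i _; rewrite mulrA.
  have yU i : y i + \sum_j H i j * u j
      = a i * phi (D (i :: t) * (linear_form b0 b + linear_form 0 ua) * l ^+ k.+1).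
    rewrite mulrDr mulrDl dual_valueD mulrDr U mulr_sumr; congr (_ + _).
    by apply: eq_bigr => j _; rewrite /H; ring.
  have := dual_value_sqr_le (b0 + 0) (fun i => b i + ua i); rewrite -linD.
  under [Y in _ <= Y -> _]eq_bigr do rewrite -yU.
  under [Y in _ -> _ <= Y]eq_bigr do rewrite wE.
  apply: le_trans; rewrite le_eqVlt; apply/orP; left; apply/eqP.
  have -> : D t * (linear_form b0 b + linear_form 0 ua) ^+ 2 * l ^+ k.+1
     = D t * linear_form b0 b ^+ 2 * l ^+ k.+1
       + D t * linear_form 0 ua * (linear_form b0 b * l ^+ k.+1) *+ 2
       + D t * linear_form 0 ua * (linear_form 0 ua * l ^+ k.+1) by ring.
  rewrite mulr2n !dual_valueD -/q !U -mulr2n; congr (_ + _ *+ 2 + _).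
    by apply: eq_bigr => i _; rewrite /y [D _ * (_ * _)]mulrA.
  apply: eq_bigr => i _; rewrite [D _ * (_ * _)]mulrA U; congr (_ * _).
  rewrite mulr_sumr.
  by apply: eq_bigr => j _; rewrite /H; ring.
(* In the equality case [y = 0], so the induction hypothesis makes every summand of [q] nonpositive.
   As they add up to 0, each vanishes and the equality case holds along every independent
   [i :: t]. *)
split=> // q00; have {}y0 := qy q00; apply: kernel_step => i E.
have [hi|ni] := boolP (ind (i :: t)); last by rewrite -mulrA dual_value_dep.
have an0 j : a j != 0 by rewrite gt_eqF.
have phi0 j : phi (D (j :: t) * linear_form b0 b * l ^+ k.+1) = 0.
  by apply/eqP; have /eqP := y0 j; rewrite mulf_eq0 (negPf (an0 j)).
have le0 j : a j * phi (D (j :: t) * linear_form b0 b ^+ 2 * l ^+ k) <= 0.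
  have [hj|nj] := boolP (ind (j :: t)).
    by rewrite pmulr_rle0 //; have [] := IH hj (phi0 j).
  by rewrite -mulrA dual_value_dep ?mulr0.
move/eqP: q00; rewrite /q dual_value_ell_exp -oppr_eq0 -sumrN.
rewrite psumr_eq0 => [|j _]; last by rewrite oppr_ge0.
move/allP/(_ i (mem_index_enum _)); rewrite /= oppr_eq0 mulf_eq0 (negPf (an0 i)).
by move=> /= /eqP qi; have [_ /(_ qi)] := IH hi (phi0 i); apply.
Qed.
End Step.

Lemma hodge_riemann_indep k t : ind t -> (size t + k.+2)%N = r ->
  hodge_riemann_at k t.
Proof.
elim: k t => [|k IH] t ht tk; first exact: hodge_riemann_rank2.
by apply: hodge_riemann_step => // i hi; apply: IH; rewrite //= addSnnS.
Qed.

(** * Hard Lefschetz in degree one *)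

Section Main.
Variable k : nat.
Hypothesis rk : r = k.+2.

Lemma hodge_riemann_degree1 V : V \is 1.-homog -> phi (V * l ^+ k.+1) = 0 ->
  phi (V ^+ 2 * l ^+ k) <= 0 /\
  (phi (V ^+ 2 * l ^+ k) = 0 -> V \in annihilator (reduced_indep_poly R M)).
Proof.
move=> /homog1_lin[b0 [b ->]] h.
have h0 : ind [::].
  by rewrite /indep_seq /=; suff -> : [set x in [::]] = set0 :> {set 'I_n};
     [exact: indep0 | apply/setP => x; rewrite !inE].
have := @hodge_riemann_indep k [::] h0 (esym rk) b0 b.
rewrite /hodge_riemann_at big_nil !mul1r => /(_ h)[le0 eq0]; split=> // /eq0 {}eq0.
exact/annihilatorP.
Qed.

(** If [l ^+ k * V] annihilates, then [phi (V * l ^+ k.+1)] and [phi (V ^+ 2 * l ^+ k)] both vanish,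
    which is the equality case of Hodge-Riemann. *)
Lemma hard_lefschetz V : V \is 1.-homog ->
  l ^+ k * V \in annihilator (reduced_indep_poly R M) ->
  V \in annihilator (reduced_indep_poly R M).
Proof.
move=> hV /annihilatorP h; have [||_] := @hodge_riemann_degree1 V => //.
  by rewrite -(h l); congr phi; rewrite exprSr; ring.
by apply; rewrite -(h V); congr phi; ring.
Qed.

(** Surjectivity follows by duality: [H] is the Gram matrix of the form on linear operators, and by
    [hard_lefschetz] its kernel lies in the annihilator, where pairing with [E] gives 0. So the
    linear system for the pairings of [V] is solvable. *)
Lemma hard_lefschetz_onto E : E \is k.+1.-homog ->
  exists2 V, V \is 1.-homog &
    l ^+ k * V - E \in annihilator (reduced_indep_poly R M).
Proof.
move=> hE.
have lhom : l \is 1.-homog by rewrite ell_formE lin_homog.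
have lkhom : l ^+ k \is k.-homog by have := dhomogMn k lhom; rewrite mul1n.
pose sumX (v : 'I_n.+1 -> R) : {mpoly R[n.+1]} := \sum_i v i *: 'X_i.
have sumX_homog v : sumX v \is 1.-homog.
  by apply: rpred_sum => i _; apply: rpredZ; rewrite dhomogX /= mdeg1.
have sumXE v F : phi (F * sumX v) = \sum_i phi (F * 'X_i) * v i.
  rewrite mulr_sumr dual_value_sum; apply: eq_bigr => i _.
  by rewrite -scalerAr dual_valueZ mulrC.
pose H : 'M[R]_n.+1 := \matrix_(i, j) phi (l ^+ k * 'X_i * 'X_j).
have /submxP[v vE] : (\row_j phi (E * 'X_j) <= H)%MS.
  rewrite submxE; apply/eqP/rowP => j; rewrite !mxE.
  pose u i := cokermx H i j.
  have uE i : phi (l ^+ k * 'X_i * sumX u) = 0.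
    have := congr1 (fun A : 'M_n.+1 => A i j) (mulmx_coker H).
    rewrite !mxE sumXE => h; rewrite -[RHS]h; apply: eq_bigr => i' _.
    by rewrite mxE.
  have uX v : phi (l ^+ k * sumX u * sumX v) = 0.
    rewrite sumXE big1 // => i _.
    by rewrite mulrAC uE mul0r.
  have : sumX u \in annihilator (reduced_indep_poly R M).
    apply: hard_lefschetz => //; apply/annihilatorP.
    apply: dual_value_monomials => m.
    have [/mdeg1P[i /eqP ->]|m1] := boolP (mdeg m == 1%N).
      by rewrite mulrAC uE.
    apply: (@dual_value_homog _ (k + 1 + mdeg m)%N); last by rewrite rk; lia.
    by apply: dhomogM; [apply: dhomogM | rewrite dhomogX].
  move=> /annihilatorP /(_ E); rewrite mulrC sumXE => h; rewrite -[RHS]h.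
  by apply: eq_bigr => i _; rewrite mxE.
exists (sumX (v ord0)) => //; apply/annihilatorP.
have hD : l ^+ k * sumX (v ord0) - E \is k.+1.-homog.
  by apply: rpredB => //; have := dhomogM lkhom (sumX_homog (v ord0)); rewrite addn1.
(* The difference has degree [r - 1], so only its pairings with single variables can be nonzero. *)
apply: dual_value_monomials => m.
have [/mdeg1P[j /eqP ->]|m1] := boolP (mdeg m == 1%N); last first.
  apply: (@dual_value_homog _ (k.+1 + mdeg m)%N); last by rewrite rk; lia.
  by apply: dhomogM; rewrite ?dhomogX.
rewrite mulrBl -scaleN1r dual_valueD dual_valueZ.
have := congr1 (fun A : 'rV_n.+1 => A ord0 j) vE; rewrite !mxE => ->.
rewrite mulrAC sumXE mulN1r; apply/eqP; rewrite subr_eq0; apply/eqP.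
by apply: eq_bigr => i _; rewrite mxE mulrC; congr (_ * phi _); ring.
Qed.

End Main.
End Positive.
End IndependencePolynomial.

(** * Transfer to the apolar quotient *)

Lemma pi_apolarX (R : comNzRingType) (k e : nat) (g D : {mpoly R[k]}) :
  (\pi_(apolar g) D ^+ e)%qT = (\pi_(apolar g) (D ^+ e))%qT.
Proof.
elim: e => [|e IH]; first by [].
by rewrite !exprS pi_apolarM IH.
Qed.

Lemma pi_apolar_eq0 (R : comNzRingType) (k : nat) (g D : {mpoly R[k]}) :
  ((\pi_(apolar g) D)%qT == 0) = (D \in annihilator g).
Proof.
rewrite -[D in RHS]subr0; apply/eqP/apolar_eqP => ->; last by rewrite raddf0.
by rewrite raddf0.
Qed.

Theorem theorem4p1 (R : realType) (n r : nat) (M : matroid n)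
    (hrank : rank M = r) (hr : (2 <= r)%N)
    (a : 'I_n -> R) (ha : forall i : 'I_n, 0 < a i) :
  HRR1 r (reduced_indep_poly R M) (ell_form a).
Proof.
(* Writing the rank as [k.+2] makes the truncated exponents [r - 2] and [r - 1] equal to [k] and
   [k.+1]. *)
case: r hrank hr => [|[|k]] // rk _; rewrite /HRR1 /HR_form !subSS !subn0.
rewrite !pi_apolarX; split.
- move=> _ _ [D hD ->] [E hE ->]; rewrite -!pi_apolarM => /apolar_eqP h.
  apply/apolar_eqP; apply: (hard_lefschetz ha rk); first exact: rpredB.
  by rewrite mulrBr.
- move=> _ [E hE ->]; have [V hV h] := hard_lefschetz_onto ha rk hE.
  by exists (\pi V)%qT; [exists V | rewrite -pi_apolarM; apply/apolar_eqP].
move=> _ [V hV ->].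
rewrite -(pi_apolarM (reduced_indep_poly R M) (_ ^+ k.+1) V) => /eqP.
rewrite !pi_apolar_eq0.
move=> /annihilatorP h nV.
rewrite -(pi_apolarM (reduced_indep_poly R M) V (_ ^+ k)).
rewrite -(pi_apolarM (reduced_indep_poly R M) (V * _) V) mulrAC -expr2.
rewrite apolar_eval_pi oppr_gt0.
have [|le0 eq0] := hodge_riemann_degree1 ha rk hV.
  by rewrite -(h 1); congr dual_value; ring.
(* Equality is excluded because it would put [V] in the annihilator, making its class 0. *)
rewrite lt_neqAle le0 andbT; apply: contra nV => /eqP; exact: eq0.
Qed.
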